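(* Let $(X,R,C)$ be a commutative association scheme and $Y\subset X$ a non-empty subset. Then the following conditions are equivalent. (1) $\lambda_i(Y)/k_i$ is independent of the choice of $i\in C$ except $i=i_0$. (2) $\lambda_i(Y)/k_i=((\#Y)^2-\#Y)/(\#X-1)$ for every $i\in C$, $i\ne i_0$, and $\lambda_{i_0}(Y)=\#Y$. (3) $\displaystyle\frac{\partial_\rho(Y)}{\sqrt{\dim V_\rho}}=\sqrt{\frac{1/\#Y-1/\#X}{\#X-1}}$ for every $\rho\in\widehat{X}$, $\rho\ne j_0$, and $\partial_{j_0}(Y)=\sqrt{1/\#X}$. (4) $\partial_\rho(Y)/\sqrt{\dim V_\rho}$ is independent of the choice of $\rho\in\widehat{X}\setminus\{j_0\}$. (5) Equality holds in the inequality $\displaystyle D(Y)\ge\sqrt{\frac{1/\#Y-1/\#X}{\#X-1}}$.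
   Context: Let $X$ be a non-empty finite set, $C$ a finite set with a specified element $i_0$, and $R:X\times X\to C$ surjective. For $i\in C$ let $A_i$ be the complex $X\times X$ matrix with $A_i(x,y)=1$ if $R(x,y)=i$ and $0$ otherwise. $(X,R,C)$ is an association scheme if $A_{i_0}$ is the identity matrix, for each $i$ there is $i'$ with ${}^tA_i=A_{i'}$, and the linear span $A_X$ of the $A_i$ is closed under matrix multiplication; it is commutative if the algebra $A_X$ is. $k_i$ (the valency) is the number of ones in a column of $A_i$, independent of the column. Put $\lambda_i(Y)=\#\{(x,y)\in Y^2\mid R(x,y)=i\}$. In the commutative case, $A_X$ acts on $\mathbb{C}[X]\cong\mathbb{C}^X$ (functions on $X$, or column vectors indexed by $X$), with inner product $\langle f,g\rangle=\sum_{x\in X}f(x)\overline{g(x)}$ and norm $\|f\|=\sqrt{\langle f,f\rangle}$; its elements are simultaneously diagonalizable. $\widehat{X}$ is the set of distinct ring homomorphisms $\rho:A_X\to\mathbb{C}$ giving the action of $A_X$ on common eigenvectors, and $V_\rho\subset\mathbb{C}[X]$ is the largest subspace on which $A_X$ acts via $\rho$; then $\mathbb{C}[X]=\bigoplus_{\rho\in\widehat X}V_\rho$ orthogonally. The component of $f$ in $V_\rho$ is $f_\rho$. $j_0\in\widehat{X}$ is the trivial representation $j_0(A_i)=k_i$, with $V_{j_0}$ spanned by the all-ones vector. $\mathcal{I}_Y:=\frac1{\#Y}\delta_Y$, where $\delta_Y$ is the indicator function of $Y$; $\mathcal{I}_Y^\rho$ is its $\rho$-component; $\partial_\rho(Y):=\|\mathcal{I}_Y^\rho\|$;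 and $D(Y):=\max_{\rho\in\widehat{X}\setminus\{j_0\}}\frac{\partial_\rho(Y)}{\sqrt{\dim V_\rho}}$. *)

(* Defs.v *)
From HB Require Import structures.
From mathcomp Require Import all_boot all_order all_algebra finmap.
From mathcomp Require Import boolp classical_sets functions cardinality reals.
From mathcomp Require Import complex.

Set Implicit Arguments.
Unset Strict Implicit.
Unset Printing Implicit Defensive.

Import Order.TTheory GRing.Theory Num.Theory.
Local Open Scope ring_scope.

(* Vectors and matrices indexed by a finite set X are indexed by 'I_#|X|
   through enum_val : 'I_#|X| -> X. *)

Definition adjmx (R : realType) (X C : finType) (r : X -> X -> C) (i : C) :
    'M[R[i]]_#|X| :=
  \matrix_(a, b) (r (enum_val a) (enum_val b) == i)%:R.

Definition adjspan (R : realType) (X C : finType) (r : X -> X -> C) :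
    {vspace 'M[R[i]]_#|X|} :=
  <<[seq adjmx R r i | i <- enum C]>>%VS.

Record assocScheme (R : realType) (X C : finType) := AssocScheme {
  rel_of : X -> X -> C;
  idx0 : C;
  scheme_nonempty : (0 < #|X|)%N;
  scheme_surj : forall i, exists x y, rel_of x y = i;
  scheme_id : adjmx R rel_of idx0 = 1%:M;
  scheme_tr : forall i, exists i', (adjmx R rel_of i)^T = adjmx R rel_of i';
  scheme_mul : forall M N, M \in adjspan R rel_of -> N \in adjspan R rel_of ->
    M *m N \in adjspan R rel_of
}.

Lemma rmorph_ext (A B : pzRingType) (f g : {rmorphism A -> B}) :
  f =1 g -> f = g.
Proof.
move=> /funext; case: f g => [f [[f1] [f2]]] [g [[g1] [g2]]] /= fg.
subst g; do ![f_equal; try exact: Prop_irrelevance].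
Qed.

(* Needed to form {fset {rmorphism A -> B}}; by rmorph_ext, equality of ring
   morphisms is pointwise equality. *)
HB.instance Definition _ (A B : pzRingType) := gen_eqMixin {rmorphism A -> B}.
HB.instance Definition _ (A B : pzRingType) :=
  gen_choiceMixin {rmorphism A -> B}.

Section Scheme.
Variables (R : realType) (X C : finType) (S : assocScheme R X C).
Local Notation r := (rel_of S).
Local Notation A := (adjmx R r).
Local Notation span := (adjspan R r).
Local Notation vec := 'cV[R[i]]_#|X|.

Definition adjalg : Type := subvs_of span.

HB.instance Definition _ := Vector.on adjalg.
HB.instance Definition _ := GRing.SubZmodule.on adjalg.

Lemma adjspan_closed : subring_closed (mem span).
Proof.
split=> [|M N|M N]; rewrite -?[_ \in mem _]/(_ \in span);
  last exact: scheme_mul.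
- rewrite -[1]/(1%:M) -(scheme_id S); apply: memv_span.
  by apply: map_f; rewrite mem_enum.
- exact: rpredB.
Qed.

HB.instance Definition _ :=
  GRing.SubZmodule_isSubPzRing.Build _ _ adjalg adjspan_closed.

Definition commutative_scheme := commutative (@GRing.mul adjalg).

Lemma adjmx_in i : A i \in span.
Proof. by apply: memv_span; apply: map_f; rewrite mem_enum. Qed.

Definition adj (i : C) : adjalg := Subvs (adjmx_in i).

Lemma adjspanE M : M \in span -> exists c : C -> R[i], M = \sum_i c i *: A i.
Proof.
rewrite /adjspan span_def big_map big_enum => /memv_sumP[/= u uP ->].
have /choice[c cE] : forall i, exists k, u i = k *: A i.
  by move=> i; have /vlineP := uP i isT.
by exists c; apply: eq_bigr => i _.
Qed.

Lemma adjspan_entry M : M \in span -> forall a b a' b',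
  r (enum_val a) (enum_val b) = r (enum_val a') (enum_val b') ->
  M a b = M a' b'.
Proof.
move=> /adjspanE[c ->] a b a' b' e.
by rewrite !summxE; apply: eq_bigr => i _; rewrite !mxE e.
Qed.

Lemma scheme_diag x : r x x = idx0 S.
Proof.
have /matrixP/(_ (enum_rank x) (enum_rank x)) := scheme_id S.
rewrite !mxE eqxx enum_rankK; case: eqP => // _ /eqP.
by rewrite eq_sym oner_eq0.
Qed.

Lemma adj_colsum i b b' : \sum_a A i a b = \sum_a A i a b'.
Proof.
have D c : \sum_a A i a c = ((A i)^T *m A i) c c.
  rewrite mxE; apply: eq_bigr => a _; rewrite !mxE.
  by case: eqP; rewrite ?mulr1 ?mulr0.
rewrite !D; apply: adjspan_entry; last by rewrite !scheme_diag.
by have [i' ->] := scheme_tr S i; apply: scheme_mul; apply: adjmx_in.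
Qed.

Lemma adjspan_colsum M : M \in span -> forall b b',
  \sum_a M a b = \sum_a M a b'.
Proof.
move=> /adjspanE[c ->] b b'.
have E d : \sum_a (\sum_i c i *: A i) a d = \sum_i c i * \sum_a A i a d.
  under [LHS]eq_bigr do rewrite summxE.
  rewrite exchange_big; apply: eq_bigr => i _; rewrite mulr_sumr.
  by apply: eq_bigr => a _; rewrite mxE.
by rewrite !E; apply: eq_bigr => i _; rewrite (adj_colsum i b b').
Qed.

Lemma adjspan_tr M : M \in span -> M^T \in span.
Proof.
move=> /adjspanE[c ->]; rewrite linear_sum; apply: memv_suml => i _.
by rewrite linearZ; have [i' /= ->] := scheme_tr S i; apply/memvZ/adjmx_in.
Qed.

(* The column used to read off valencies; by valencyP the choice is
   immaterial. *)
Definition base : 'I_#|X| := Ordinal (scheme_nonempty S).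

Definition valency (i : C) : nat := #|[set x | r x (enum_val base) == i]|.

Lemma colsum_card i b :
  \sum_a A i a b = #|[set x | r x (enum_val b) == i]|%:R.
Proof.
rewrite -sum1_card natr_sum.
rewrite [RHS]big_mkcond (reindex (@enum_val X predT)) /=; last first.
  by exists enum_rank => j _; rewrite ?enum_valK ?enum_rankK.
by apply: eq_bigr => a _; rewrite !mxE inE; case: eqP.
Qed.

Lemma valencyP i y : #|[set x | r x y == i]| = valency i.
Proof.
apply/eqP; rewrite -(eqr_nat R[i]); apply/eqP.
rewrite -[in LHS](enum_rankK y) -!colsum_card; exact: adj_colsum.
Qed.

(* The linear functional on the algebra mapping the i-th adjacency matrix to
   its valency (see j0_adj). *)
Definition j0_fun (M : adjalg) : R[i] := \sum_a val M a base.

Fact j0_additive : zmod_morphism j0_fun.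
Proof.
move=> M N; rewrite /j0_fun -sumrB; apply: eq_bigr => a _.
by rewrite !mxE.
Qed.

Fact j0_monoid : monoid_morphism j0_fun.
Proof.
split=> [|M N]; rewrite /j0_fun.
  rewrite (bigD1 base) //= big1 ?addr0 => [|a ne]; rewrite mxE ?eqxx //.
  by rewrite (negPf ne).
rewrite mulr_sumr.
under [LHS]eq_bigr do rewrite mxE.
rewrite exchange_big; apply: eq_bigr => c _.
rewrite -mulr_suml; congr (_ * _).
exact: (adjspan_colsum (valP M)).
Qed.

HB.instance Definition _ := GRing.isZmodMorphism.Build adjalg R[i] j0_fun
  j0_additive.
HB.instance Definition _ := GRing.isMonoidMorphism.Build adjalg R[i] j0_fun
  j0_monoid.

Definition j0 : {rmorphism adjalg -> R[i]} := j0_fun.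

Lemma j0_adj i : j0 (adj i) = (valency i)%:R.
Proof. exact: colsum_card. Qed.

Definition Xhat_set : set {rmorphism adjalg -> R[i]} :=
  [set rho | exists2 v : vec, v != 0 &
     forall M : adjalg, val M *m v = rho M *: v].

Lemma Xhat_linear rho (c : C -> R[i]) (M : adjalg) : Xhat_set rho ->
  val M = \sum_i c i *: A i -> rho M = \sum_i c i * rho (adj i).
Proof.
move=> [v v0 act] e; apply/eqP; rewrite -subr_eq0.
suff: (rho M - \sum_i c i * rho (adj i)) *: v == 0
  by rewrite scaler_eq0 (negPf v0) orbF.
rewrite scalerBl subr_eq0 -act e mulmx_suml scaler_suml.
by apply/eqP; apply: eq_bigr => i _; rewrite -scalemxAl (act (adj i)) scalerA.
Qed.

Lemma Xhat_inj rho sigma : Xhat_set rho -> Xhat_set sigma ->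
  (forall i, rho (adj i) = sigma (adj i)) -> rho = sigma.
Proof.
move=> hr hs e; apply: rmorph_ext => M.
have [c Mc] := adjspanE (valP M).
rewrite (Xhat_linear hr Mc) (Xhat_linear hs Mc).
by apply: eq_bigr => i _; rewrite e.
Qed.

Lemma Xhat_finite : finite_set Xhat_set.
Proof.
have pr i : exists s : seq R[i], forall rho, Xhat_set rho -> rho (adj i) \in s.
  have [s es] := closed_field_poly_normal (char_poly (A i)^T).
  exists s => rho [v v0 act].
  have: root (char_poly (A i)^T) (rho (adj i)).
    rewrite -eigenvalue_root_char; apply/eigenvalueP.
    exists v^T; last by rewrite trmx_eq0.
    by rewrite -trmx_mul -[A i]/(val (adj i)) act linearZ.
  rewrite es rootZ ?root_prod_XsubC //.
  by rewrite (monicP (char_poly_monic _)) oner_eq0.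
have {pr} [s sP] : exists s : seq R[i],
    forall rho i, Xhat_set rho -> rho (adj i) \in s.
  have [t tP] := choice pr.
  exists (flatten [seq t i | i <- enum C]) => rho i /(tP i) h.
  by apply/flatten_mapP; exists i => //; rewrite mem_enum.
pose g (rho : {rmorphism adjalg -> R[i]}) : {ffun C -> 'I_(size s).+1} :=
  [ffun i => inord (index (rho (adj i)) s)].
have gi : {in Xhat_set &, injective g}.
  move=> rho sigma; rewrite !inE => hr hs /ffunP e; apply: Xhat_inj => // i.
  have /(congr1 val) := e i; rewrite !ffunE /= !inordK ?ltnS ?index_size //.
  move=> ei.
  by rewrite -(nth_index 0 (sP _ i hr)) ei nth_index // sP.
by rewrite -(eq_finite_set (inj_card_eq gi)); exact: finite_finset.
Qed.

Definition Xhat : {fset {rmorphism adjalg -> R[i]}} := fset_set Xhat_set.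

Lemma XhatP (rho : {rmorphism adjalg -> R[i]}) : reflect
  (exists2 v : vec, v != 0 & forall M : adjalg, val M *m v = rho M *: v)
  (rho \in Xhat).
Proof. by rewrite in_fset_set ?inE; [exact: asboolP | exact: Xhat_finite]. Qed.

Definition eigsp (rho : {rmorphism adjalg -> R[i]}) : {vspace vec} :=
  (\bigcap_(i : C) lker (linfun (mulmx (A i)) - rho (adj i) *: \1%VF))%VS.

(* eigspP and eigsp_max: eigsp rho is the largest subspace on which the whole
   algebra acts through rho, although only the generators appear above. *)
Lemma eigspP (rho : {rmorphism adjalg -> R[i]}) v : rho \in Xhat ->
  reflect (forall M : adjalg, val M *m v = rho M *: v) (v \in eigsp rho).
Proof.
move=> /XhatP hr.
have lk i : (v \in lker (linfun (mulmx (A i)) - rho (adj i) *: \1%VF))%VS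
    = (A i *m v == rho (adj i) *: v).
  by rewrite memv_ker !lfun_simp /= subr_eq0.
rewrite memvE; apply: (iffP subv_bigcapP) => [h M|h i _]; last first.
  by rewrite -memvE lk -(h (adj i)).
have [c Mc] := adjspanE (valP M).
rewrite (Xhat_linear hr Mc) Mc mulmx_suml scaler_suml; apply: eq_bigr => i _.
have := h i isT; rewrite -memvE lk => /eqP e.
by rewrite -scalemxAl e scalerA.
Qed.

Lemma eigsp_max (rho : {rmorphism adjalg -> R[i]}) (U : {vspace vec}) :
  rho \in Xhat ->
  (forall v, v \in U -> forall M : adjalg, val M *m v = rho M *: v) ->
  (U <= eigsp rho)%VS.
Proof. by move=> hr h; apply/subvP => v /h/(eigspP _ hr). Qed.

Lemma j0_Xhat : j0 \in Xhat.
Proof.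
apply/XhatP; exists (const_mx 1).
  by apply/eqP => /matrixP/(_ base 0)/eqP; rewrite !mxE oner_eq0.
move=> M; apply/matrixP => a b; rewrite !mxE mulr1.
under eq_bigr do rewrite mxE mulr1.
have rowE a' : \sum_c val M a' c = \sum_c val M a c.
  have := adjspan_colsum (adjspan_tr (valP M)) a' a.
  under eq_bigr do rewrite mxE; move=> ->.
  by apply: eq_bigr => c _; rewrite mxE.
have n0 : #|X|%:R != 0 :> R[i] by rewrite pnatr_eq0 -lt0n (scheme_nonempty S).
apply: (mulfI n0).
have sum_cst (x : R[i]) : #|X|%:R * x = \sum_(c < #|X|) x.
  by rewrite sumr_const card_ord mulr_natl.
rewrite !sum_cst -(eq_bigr _ (fun a' _ => rowE a')).
rewrite exchange_big /=; apply: eq_bigr => c _.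
exact: (adjspan_colsum (valP M)).
Qed.

(* The component for the direct sum of all the eigsp sigma, sigma in Xhat. *)
Definition component (rho : {rmorphism adjalg -> R[i]}) (f : vec) : vec :=
  daddv_pi (eigsp rho) (\sum_(sigma <- Xhat | sigma != rho) eigsp sigma)%VS f.

Definition inner (f g : vec) : R[i] := \sum_a f a 0 * (g a 0)^*.

(* inner f f is a nonnegative real, so nothing is lost by taking its real
   part. *)
Definition norm2 (f : vec) : R := Num.sqrt (complex.Re (inner f f)).

Definition avg (Y : {set X}) : vec :=
  \col_a (#|Y|%:R^-1 * (enum_val a \in Y)%:R).

Definition pnorm (Y : {set X}) (rho : {rmorphism adjalg -> R[i]}) : R :=
  norm2 (component rho (avg Y)).

(* The default value 0 does not affect a maximum of nonnegative ratios; it only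
   fixes the value over an empty range, i.e. when #|X| = 1. *)
Definition maxratio (Y : {set X}) : R :=
  \big[Num.max/0]_(rho <- Xhat | rho != j0)
    (pnorm Y rho / Num.sqrt (\dim (eigsp rho))%:R).

Definition lam (Y : {set X}) (i : C) : nat :=
  #|[set p : X * X | [&& p.1 \in Y, p.2 \in Y & r p.1 p.2 == i]]|.

End Scheme.

(* Main.v *)
From HB Require Import structures.
Require Import Defs.
From mathcomp Require Import all_boot all_order all_algebra finmap.
From mathcomp Require Import boolp reals complex ring lra.

(** Write N = #|X|, q_rho for the squared length of the component of I_Y in
    V_rho and m_rho = dim V_rho.  Two systems of equations, indexed by i, tie
    the combinatorics of Y to its spectrum:

      lam_i(Y) / #|Y|^2     = sum_rho rho(A_i) q_rho   [lam_spectral],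
      N [i = i_0]           = sum_rho rho(A_i) m_rho   [trace_spectral].

    The first evaluates the quadratic form <A_i I_Y, I_Y> in an orthonormal
    basis of common eigenvectors, the second the trace of A_i.  Such a basis
    exists because A_X is a commuting family closed under adjoints
    [spectral_theorem].

    Let tau = (1/#|Y| - 1/N) / (N - 1).  Subtracting tau times the second
    system from the first, and using k_i = j_0(A_i), gives

      lam_i(Y) / #|Y|^2 - k_i (1/N - tau) - tau N [i = i_0]
        = sum_rho rho(A_i) (q_rho - tau m_rho - (1/N - tau) [rho = j_0]).

    The characters rho are linearly independent [character_independence], so
    all the left-hand sides vanish if and only if all the coefficients on the
    right do.  At i = i_0 and at rho = j_0 (where q = 1/N and m = 1) this is
    automatic, so conditions (2) and (3) are equivalent [design_duality,
    uniform_lamP].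

    The other conditions reduce to these because the relevant totals are
    known. Summing over i <> i_0, the k_i give N - 1 and the lam_i give #|Y|^2
    - #|Y|, so a common ratio lam_i / k_i can only be that of (2). Summing
    over rho <> j_0, the m_rho give N - 1 and the q_rho give 1/#|Y| - 1/N,
    that is, tau times as much. Hence a common ratio q_rho / m_rho can only be
    tau; and if tau bounds all the ratios, then all the inequalities q_rho <=
    tau m_rho are equalities, which is what (5) provides.

    For N = 1 there is neither an i <> i_0 nor a rho <> j_0; tau is then 0 / 0,
    which is 0, and so is the maximum over the empty range in (5). *)

Set Implicit Arguments.
Unset Strict Implicit.
Unset Printing Implicit Defensive.

Import Order.TTheory GRing.Theory Num.Theory.
Local Open Scope ring_scope.

Section AssociationScheme.
Local Open Scope sesquilinear_scope.
Context {R : realType} {X C : finType} {S : assocScheme R X C}.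
Local Notation r := (rel_of S).
Local Notation A := (adjmx R r).
Local Notation vec := 'cV[R[i]]_#|X|.
Local Notation character := {rmorphism adjalg S -> R[i]}.

(** * Simultaneous diagonalization of the adjacency algebra *)

Lemma adjmx_trC i : (A i)^t* = (A i)^T.
Proof. by apply/matrixP=> a b; rewrite !mxE rmorph_nat. Qed.

(** A commuting family is unitarily conjugate to a family of lower triangular
    matrices.  Here the adjoint of each A_i is some A_i', also in the family, so
    the conjugate of A_i is upper triangular as well. *)
Lemma unitary_codiagonalization : commutative_scheme S ->
  exists2 U : 'M[R[i]]_#|X|, U \is unitarymx &
    forall M : adjalg S, is_diag_mx (U *m val M *m U^t*).
Proof.
move=> Scomm.
have comm : {in [seq A i | i <- enum C] &, forall M N, comm_mx M N}.
  move=> _ _ /mapP[i _ ->] /mapP[j _ ->].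
  exact: (congr1 val (Scomm (adj S i) (adj S j))).
have [U Uu /allP trigU] := cotrigonalization comm; exists U => //.
have {}trigU i : is_trig_mx (U *m A i *m U^t*).
  have /trigU : A i \in [seq A i | i <- enum C] by rewrite map_f ?mem_enum.
  by rewrite /similar_to /= conjymx.
have diagA i : is_diag_mx (U *m A i *m U^t*).
  apply/is_diag_mxP => a b; case: ltngtP => // [lt_ab|lt_ba] _.
    by have /is_trig_mxP-> := trigU i.
  have [i' Ai'] := scheme_tr S i.
  have e : U *m A i *m U^t* = (U *m A i' *m U^t*)^t*.
    by rewrite -Ai' -adjmx_trC !trmx_mul !map_mxM /= !trmxCK mulmxA.
  by rewrite e 2!mxE; have /is_trig_mxP-> // := trigU i'; rewrite conjC0.
move=> M; have [c ->] := adjspanE (valP M).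
rewrite mulmx_sumr mulmx_suml; apply/is_diag_mxP => a b ab.
rewrite summxE big1 // => i _; rewrite -scalemxAr -scalemxAl mxE.
by have /is_diag_mxP-> := diagA i; rewrite ?mulr0.
Qed.

(** Each diagonal position of the simultaneous diagonal form is multiplicative
    on the algebra, hence carries a character. *)
Lemma spectral_theorem : commutative_scheme S ->
  exists U : 'M[R[i]]_#|X|, exists chi : 'I_#|X| -> character,
    U \is unitarymx /\
    forall M : adjalg S, U *m val M *m U^t* = diag_mx (\row_k chi k M).
Proof.
move=> /unitary_codiagonalization[U Uu Ud].
have Udiag (M : adjalg S) a b : a != b -> (U *m val M *m U^t*) a b = 0.
  by move=> ab; have /is_diag_mxP-> := Ud M.
have UtU : U^t* *m U = 1%:M by rewrite -invmx_unitary // mulVmx ?unitarymx_unit.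
suff /choice[chi chiE] : forall k, exists chi : character,
    forall M : adjalg S, chi M = (U *m val M *m U^t*) k k.
  exists U, chi; split=> // M; apply/matrixP=> a b.
  rewrite [RHS]mxE [X in X *+ _]mxE.
  by case: eqVneq => [<-|/Udiag->]; rewrite ?mulr1n ?mulr0n ?chiE.
move=> k; pose f (M : adjalg S) := (U *m val M *m U^t*) k k.
have fB : zmod_morphism f.
  move=> M N.
  by rewrite /f -[val (M - N)]/(val M - val N) mulmxBr mulmxBl !mxE.
have fM : monoid_morphism f.
  split=> [|M N]; rewrite /f.
    rewrite -[val 1]/(1%:M) mulmx1.
    by have /unitarymxP-> := Uu; rewrite mxE eqxx.
  rewrite -[val (M * N)]/(val M *m val N).
  have -> : U *m (val M *m val N) *m U^t* =
      (U *m val M *m U^t*) *m (U *m val N *m U^t*).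
    by rewrite !mulmxA -[_ *m U^t* *m U]mulmxA UtU mulmx1.
  rewrite mxE (bigD1 k) //= big1 ?addr0 // => l lk.
  by rewrite Udiag ?mul0r // eq_sym.
pose af := GRing.isZmodMorphism.Build _ _ f fB.
pose mf := GRing.isMonoidMorphism.Build _ _ f fM.
pose chi : character := HB.pack f af mf.
by exists chi.
Qed.

(** A ring morphism A_X -> C need not be C-linear; one that describes the action
    on a common eigenvector is. *)
Lemma Xhat_scale (rho : character) : rho \in Xhat S ->
  forall c M, rho (c *: M) = c * rho M.
Proof.
move=> /XhatP[v v0 act] c M; apply/eqP; rewrite -subr_eq0.
suff: (rho (c *: M) - c * rho M) *: v == 0.
  by rewrite scaler_eq0 (negPf v0) orbF.
rewrite scalerBl subr_eq0 -scalerA -!act -[val (c *: M)]/(c *: val M).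
by rewrite scalemxAl.
Qed.

(** * Eigenspaces and components in eigencoordinates *)

Section Eigenbasis.
Variables (U : 'M[R[i]]_#|X|) (chi : 'I_#|X| -> character).
Hypotheses (Uu : U \is unitarymx)
  (chiE : forall M : adjalg S, U *m val M *m U^t* = diag_mx (\row_k chi k M)).

Lemma UtK : U^t* *m U = 1%:M.
Proof. by rewrite -invmx_unitary // mulVmx ?unitarymx_unit. Qed.

Lemma UKt : U *m U^t* = 1%:M.
Proof. exact/unitarymxP. Qed.

Lemma coord_act (M : adjalg S) (f : vec) k :
  (U *m (val M *m f)) k 0 = chi k M * (U *m f) k 0.
Proof.
have -> : U *m (val M *m f) = diag_mx (\row_k chi k M) *m (U *m f).
  by rewrite -chiE !mulmxA -[_ *m U^t* *m U]mulmxA UtK mulmx1.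
by rewrite mul_diag_mx !mxE.
Qed.

Lemma coord_inj (f g : vec) : (forall k, (U *m f) k 0 = (U *m g) k 0) -> f = g.
Proof.
move=> fg; rewrite -[f]mul1mx -[g]mul1mx -UtK -!mulmxA; congr (_ *m _).
by apply/matrixP=> k j; rewrite ord1.
Qed.

Definition eigvec k : vec := col k (U^t*).

Lemma coord_eigvec k l : (U *m eigvec k) l 0 = (l == k)%:R.
Proof. by rewrite /eigvec !colE mulmxA UKt mul1mx mxE eqxx andbT. Qed.

Lemma eigvec_decomp (f : vec) : f = \sum_k (U *m f) k 0 *: eigvec k.
Proof.
apply: coord_inj => l; rewrite mulmx_sumr summxE (bigD1 l) //= big1 => [|k kl].
  by rewrite -scalemxAr [X in _ = X + _]mxE coord_eigvec eqxx mulr1 addr0.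
by rewrite -scalemxAr mxE coord_eigvec eq_sym (negPf kl) mulr0.
Qed.

Lemma chi_Xhat k : chi k \in Xhat S.
Proof.
apply/XhatP; exists (eigvec k).
  apply/eqP=> e0; have := coord_eigvec k k.
  by rewrite e0 mulmx0 mxE eqxx => /esym/eqP; rewrite oner_eq0.
move=> M; apply: coord_inj => l; rewrite coord_act -scalemxAr [RHS]mxE.
by rewrite coord_eigvec; case: eqP => [->|]; rewrite ?mulr0.
Qed.

(** Distinct characters differ on some M, so a vector of V_rho has coordinates
    only where the character is rho. *)
Lemma mem_eigsp rho (v : vec) : rho \in Xhat S ->
  reflect (forall k, chi k != rho -> (U *m v) k 0 = 0) (v \in eigsp rho).
Proof.
move=> rhoX; apply: (iffP (eigspP _ rhoX)) => [act k|v0 M].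
  apply: contra_neq_eq => vk; apply: rmorph_ext => M; apply: (mulIf vk).
  by rewrite -coord_act act -scalemxAr mxE.
apply: coord_inj => k; rewrite coord_act -scalemxAr [RHS]mxE.
by case: (eqVneq (chi k) rho) => [->//|/v0->]; rewrite !mulr0.
Qed.

Lemma dim_eigsp rho : rho \in Xhat S ->
  \dim (eigsp rho) = #|[set k | chi k == rho]|.
Proof.
move=> rhoX; set K := [set k | _].
pose b := [tuple eigvec (enum_val j) | j < #|K|].
have bE (j : 'I_#|K|) : b`_j = eigvec (enum_val j).
  by rewrite -tnth_nth tnth_mktuple.
suff: basis_of (eigsp rho) b by move/size_basis.
rewrite basisEfree size_tuple; apply/and3P; split.
- apply/freeP => c c0 j.
  have := congr1 (fun f : vec => (U *m f) (enum_val j) 0) c0.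
  rewrite mulmx0 mulmx_sumr summxE [RHS]mxE (bigD1 j) //= big1 => [|i ij].
    by rewrite bE -scalemxAr mxE coord_eigvec eqxx mulr1 addr0.
  rewrite bE -scalemxAr mxE coord_eigvec.
  by rewrite (inj_eq enum_val_inj) eq_sym (negPf ij) mulr0.
- apply/span_subvP => _ /tnthP[j ->]; rewrite tnth_mktuple.
  apply/(mem_eigsp _ rhoX) => l; rewrite coord_eigvec.
  have [->|//] := eqVneq l (enum_val j).
  by have := enum_valP j; rewrite inE => ->.
have : (eigsp rho <= <<b>>)%VS.
  apply/subvP=> v /(mem_eigsp _ rhoX) v0; rewrite [v]eigvec_decomp.
  apply: memv_suml => k _; have [kK|kK] := boolP (k \in K); last first.
    by rewrite v0 ?scale0r ?mem0v //; move: kK; rewrite inE.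
  apply/memvZ/memv_span/tnthP; exists (enum_rank_in kK k).
  by rewrite tnth_mktuple enum_rankK_in.
move/dimvS => /leq_trans; apply.
by rewrite (leq_trans (dim_span _)) ?size_tuple.
Qed.

(** W below, the sum of the other eigenspaces, consists of vectors whose
    coordinates vanish where the character is rho.  So it meets V_rho trivially
    and spans the whole space with it, and the projection onto V_rho along W
    selects the coordinates with character rho. *)
Lemma coord_component rho (f : vec) k : rho \in Xhat S ->
  (U *m component rho f) k 0 = if chi k == rho then (U *m f) k 0 else 0.
Proof.
move=> rhoX; pose W := (\sum_(sigma <- Xhat S | sigma != rho) eigsp sigma)%VS.
have W0 v l : v \in W -> chi l == rho -> (U *m v) l 0 = 0.
  move=> vW /eqP lrho; move: v vW; rewrite /W big_seq_cond.
  elim/big_ind: _ => [v|V1 V2 h1 h2 _ /memv_addP[u /h1 u0 [w /h2 w0 ->]]|].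
  - by rewrite memv0 => /eqP->; rewrite mulmx0 mxE.
  - by rewrite mulmxDr mxE u0 w0 addr0.
  move=> sigma /andP[sX sr] v /(mem_eigsp _ sX) ->//.
  by rewrite lrho eq_sym.
have dj : (eigsp rho :&: W)%VS = 0%VS.
  apply/eqP; rewrite -subv0; apply/subvP => v; rewrite memv_cap memv0.
  move=> /andP[/(mem_eigsp _ rhoX) vr vW]; apply/eqP/coord_inj => l.
  rewrite mulmx0 [RHS]mxE; have [/W0->//|/vr//] := boolP (chi l == rho).
have fW : f \in (eigsp rho + W)%VS.
  rewrite [f]eigvec_decomp; apply: memv_suml => l _; apply: memvZ.
  have lX := chi_Xhat l.
  have le : eigvec l \in eigsp (chi l).
    apply/(mem_eigsp _ lX) => j; rewrite coord_eigvec.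
    by have [->|] := eqVneq j l; rewrite ?eqxx.
  have [<-|lr] := eqVneq (chi l) rho; first exact: (subvP (addvSl _ _)).
  apply: (subvP (addvSr _ _)); rewrite /W (big_rem _ lX) /= lr.
  exact: (subvP (addvSl _ _)).
have [u [g [ur gW -> fE]]] : exists u g,
    [/\ u \in eigsp rho, g \in W, component rho f = u & u + g = f].
  exists (component rho f), (daddv_pi W (eigsp rho) f).
  by split=> //; [exact: memv_pi | exact: memv_pi | exact: daddv_pi_add].
rewrite -fE mulmxDr [in RHS]mxE; case: ifPn => [/(W0 _ _ gW)->|].
  by rewrite addr0.
by move/(mem_eigsp _ rhoX): ur; apply.
Qed.

(** Parseval: U is unitary. *)
Lemma inner_coord (f g : vec) :
  inner f g = \sum_k (U *m f) k 0 * ((U *m g) k 0)^*.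
Proof.
have ip (u v : vec) : inner u v = (u^T *m map_mx Num.conj v) 0 0.
  by rewrite mxE; apply: eq_bigr => a _; rewrite !mxE.
rewrite -[RHS]/(inner _ _) !ip trmx_mul map_mxM mulmxA.
suff UtU : U^T *m map_mx Num.conj U = 1%:M.
  by rewrite -[_ *m _ *m map_mx _ U]mulmxA UtU mulmx1.
have /(congr1 trmx) := UtK; rewrite trmx_mul trmx1.
by rewrite map_trmx trmxK.
Qed.

End Eigenbasis.

(** * Spectral expansions *)

Lemma sum_over_Xhat (chi : 'I_#|X| -> character) (F : 'I_#|X| -> R[i]) :
  (forall k, chi k \in Xhat S) ->
  \sum_k F k = \sum_(rho <- Xhat S) \sum_(k | chi k == rho) F k.
Proof.
move=> chiX; under [RHS]eq_bigr do rewrite big_mkcond.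
rewrite exchange_big; apply: eq_bigr => k _ /=.
rewrite (bigD1_seq (chi k)) ?chiX ?fset_uniq //= eqxx big1 ?addr0 // => rho.
by rewrite eq_sym => /negPf->.
Qed.

Lemma norm2_sqr (f : vec) : (norm2 f ^+ 2)%:C%C = inner f f.
Proof.
have f0 : 0 <= inner f f by apply: sumr_ge0 => a _; exact: mul_conjC_ge0.
rewrite sqr_sqrtr ?RRe_real ?ger0_real //.
by move: f0; rewrite lecE => /andP[].
Qed.

Lemma quadratic_form_spectral : commutative_scheme S ->
  forall (M : adjalg S) (f : vec), inner (val M *m f) f =
    \sum_(rho <- Xhat S) rho M * (norm2 (component rho f) ^+ 2)%:C%C.
Proof.
move=> Scomm M f; have [U [chi [Uu chiE]]] := spectral_theorem Scomm.
rewrite (inner_coord Uu) (@sum_over_Xhat chi); last exact: chi_Xhat Uu chiE.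
apply: eq_big_seq => rho rhoX.
rewrite norm2_sqr (inner_coord Uu) mulr_sumr big_mkcond.
apply: eq_bigr => k _; rewrite (coord_component Uu chiE) //.
case: eqP => [<-|_]; last by rewrite mul0r mulr0.
by rewrite (coord_act Uu chiE) mulrA.
Qed.

Lemma trace_spectral : commutative_scheme S ->
  forall M : adjalg S, \tr (val M) =
    \sum_(rho <- Xhat S) rho M * (\dim (eigsp rho))%:R.
Proof.
move=> Scomm M; have [U [chi [Uu chiE]]] := spectral_theorem Scomm.
have -> : \tr (val M) = \tr (U *m val M *m U^t*).
  by rewrite mxtrace_mulC mulmxA (UtK Uu) mul1mx.
rewrite chiE mxtrace_diag (@sum_over_Xhat chi); last exact: chi_Xhat Uu chiE.
apply: eq_big_seq => rho rhoX.
rewrite (dim_eigsp Uu chiE) // -sum1_card natr_sum mulr_sumr.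
by apply: eq_big => [k|k /eqP krho]; rewrite ?inE // mxE krho mulr1.
Qed.

(** * Linear independence of the characters *)

(** Each sigma <> rho disagrees with rho on some M, and then M - sigma(M) 1
    is killed by sigma but not by rho; multiply these elements together. *)
Lemma separating_element (rho : character) : rho \in Xhat S ->
  exists2 E : adjalg S, rho E != 0 &
    forall sigma, sigma \in Xhat S -> sigma != rho -> sigma E = 0.
Proof.
move=> rhoX.
have /choice[E_ EP] : forall sigma : character, exists E : adjalg S,
    sigma \in Xhat S -> sigma != rho -> rho E != 0 /\ sigma E = 0.
  move=> sigma; have [->|sr] := eqVneq sigma rho; first by exists 0.
  have /existsNP[M Msr] : ~ (forall M, sigma M = rho M).
    by move=> e; case/eqP: sr; exact: rmorph_ext.
  exists (M - sigma M *: (1 : adjalg S)) => sX _.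
  rewrite !rmorphB !Xhat_scale // !rmorph1.
  by rewrite !mulr1 subrr subr_eq0 eq_sym; split=> //; apply/eqP.
exists (\prod_(sigma <- Xhat S | sigma != rho) E_ sigma).
  rewrite rmorph_prod prodf_seq_neq0; apply/allP => sigma sX.
  by apply/implyP => sr; have [] := EP _ sX sr.
move=> sigma sX sr; rewrite rmorph_prod (big_rem sigma sX) /= sr.
by have [_ ->] := EP _ sX sr; rewrite mul0r.
Qed.

(** By linearity the relation extends from the A_i to all of A_X; evaluate it at
    an element that separates rho from the other characters. *)
Lemma character_independence (a : character -> R[i]) :
  (forall i, \sum_(rho <- Xhat S) rho (adj S i) * a rho = 0) ->
  forall rho, rho \in Xhat S -> a rho = 0.
Proof.
move=> a0 rho rhoX; have [E rE sE] := separating_element rhoX.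
have [c Ec] := adjspanE (valP E).
apply: (mulfI rE); rewrite mulr0.
transitivity (\sum_(sigma <- Xhat S) sigma E * a sigma).
  rewrite (bigD1_seq rho) ?fset_uniq //= big_seq_cond big1 ?addr0 // => sigma.
  by case/andP=> sX sr; rewrite sE ?mul0r.
transitivity (\sum_i c i * \sum_(sigma <- Xhat S) sigma (adj S i) * a sigma).
  under [RHS]eq_bigr do rewrite mulr_sumr.
  rewrite exchange_big; apply: eq_big_seq => sigma /XhatP sX /=.
  rewrite (Xhat_linear sX Ec) mulr_suml.
  by apply: eq_bigr => i _; rewrite mulrA.
by rewrite big1 // => i _; rewrite a0 mulr0.
Qed.

(** * Counting pairs *)

Lemma rel_idx0 x y : (r x y == idx0 S) = (x == y).
Proof.
have /matrixP/(_ (enum_rank x) (enum_rank y)) := scheme_id S.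
rewrite !mxE !enum_rankK (inj_eq enum_rank_inj).
by do 2!case: eqP => // _; move/eqP; rewrite ?(eq_sym 0) oner_eq0.
Qed.

Lemma valency_gt0 i : (0 < valency S i)%N.
Proof.
have [x [y xyi]] := scheme_surj S i.
by rewrite -(valencyP S i y); apply/card_gt0P; exists x; rewrite inE xyi.
Qed.

Lemma sum_fibers (T : finType) (P : {set T}) (f : T -> C) :
  (\sum_i #|[set p in P | f p == i]|)%N = #|P|.
Proof.
rewrite -[RHS]sum1_card (partition_big f predT) //=; apply: eq_bigr => i _.
by rewrite -sum1_card; apply: eq_bigl => p; rewrite inE.
Qed.

Lemma sum_valency : (\sum_i valency S i)%N = #|X|.
Proof.
rewrite -cardsT -(sum_fibers [set: X] (r^~ (enum_val (base S)))).
by apply: eq_bigr => i _; apply: eq_card => x; rewrite !inE.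
Qed.

Lemma sum_lam (Y : {set X}) : (\sum_i lam S Y i)%N = (#|Y| ^ 2)%N.
Proof.
rewrite -mulnn -cardsX -(sum_fibers (setX Y Y) (fun p => r p.1 p.2)).
by apply: eq_bigr => i _; apply: eq_card => x; rewrite !inE andbA.
Qed.

Lemma lam_idx0 (Y : {set X}) : lam S Y (idx0 S) = #|Y|.
Proof.
rewrite -(card_imset Y (f := fun x => (x, x))) => [|x y []//].
apply: eq_card => -[x y]; rewrite !inE rel_idx0 /=.
apply/and3P/imsetP => [[xY _ /eqP<-]|[z zY [-> ->]]]; first by exists x.
by [].
Qed.

Lemma valency_idx0 : valency S (idx0 S) = 1%N.
Proof.
rewrite /valency -(cards1 (enum_val (base S))); apply: eq_card => x.
by rewrite !inE rel_idx0.
Qed.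

Lemma sum_valency_neq :
  \sum_(i | i != idx0 S) (valency S i)%:R = #|X|%:R - 1 :> R.
Proof.
apply/eqP; rewrite eq_sym subr_eq -sum_valency natr_sum.
by rewrite (bigD1 (idx0 S)) //= valency_idx0 addrC.
Qed.

Lemma sum_lam_neq (Y : {set X}) :
  \sum_(i | i != idx0 S) (lam S Y i)%:R = #|Y|%:R ^+ 2 - #|Y|%:R :> R.
Proof.
apply/eqP; rewrite eq_sym subr_eq -natrX -sum_lam natr_sum.
by rewrite (bigD1 (idx0 S)) //= lam_idx0 addrC.
Qed.

Lemma cardX_gt1 i : i != idx0 S -> 0 < #|X|%:R - 1 :> R.
Proof.
move=> ii0; rewrite -sum_valency_neq (bigD1 i) //=.
by rewrite ltr_pwDl ?ltr0n ?valency_gt0 // sumr_ge0.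
Qed.

Lemma trace_adj i : \tr (val (adj S i)) = #|X|%:R * (i == idx0 S)%:R.
Proof.
rewrite /mxtrace; under eq_bigr do rewrite mxE scheme_diag.
by rewrite sumr_const card_ord eq_sym mulr_natl.
Qed.

Lemma inner_adj_avg (Y : {set X}) i :
  inner (val (adj S i) *m avg R Y) (avg R Y) = (lam S Y i)%:R / #|Y|%:R ^+ 2.
Proof.
have -> : (lam S Y i)%:R = \sum_a \sum_b A i a b
    * (enum_val a \in Y)%:R * (enum_val b \in Y)%:R :> R[i].
  have reix (F : X -> R[i]) : \sum_x F x = \sum_(a < #|X|) F (enum_val a).
    rewrite (reindex (@enum_val X predT)) //=.
    by exists enum_rank => j _; rewrite ?enum_valK ?enum_rankK.
  transitivity (\sum_x \sum_y
      ((r x y == i)%:R * (x \in Y)%:R * (y \in Y)%:R) : R[i]).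
    rewrite pair_big /lam -sum1_card natr_sum big_mkcond.
    apply: eq_bigr => -[x y] _ /=.
    rewrite inE /=; case: (x \in Y); case: (y \in Y); case: eqP => _;
      by rewrite ?(mulr0, mulr1, mul0r).
  rewrite reix; apply: eq_bigr => a _; rewrite reix; apply: eq_bigr => b _.
  by rewrite !mxE.
rewrite /inner mulr_suml; apply: eq_bigr => a _.
rewrite !mxE !mulr_suml; apply: eq_bigr => b _; rewrite !mxE.
by rewrite rmorphM /= fmorphV !rmorph_nat -exprVn; ring.
Qed.

(** * The trivial character *)

Lemma character_idx0 (rho : character) : rho (adj S (idx0 S)) = 1.
Proof.
have -> : adj S (idx0 S) = 1 by apply: val_inj; exact: scheme_id.
exact: rmorph1.
Qed.

(** The sum of the A_i is the all-ones matrix J, so multiplying by M on the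
    right replaces each entry by the column sum of M. *)
Lemma sum_adj_absorb (M : adjalg S) :
  (\sum_i adj S i) * M = j0 S M *: \sum_i adj S i.
Proof.
have JE a b : val (\sum_i adj S i) a b = 1.
  rewrite raddf_sum summxE (bigD1 (r (enum_val a) (enum_val b))) //=.
  rewrite mxE eqxx big1 ?addr0 // => i; rewrite mxE eq_sym.
  by move=> /negPf->.
apply: val_inj; apply/matrixP => a b.
rewrite [RHS]mxE JE mulr1 [LHS]mxE.
under eq_bigr do rewrite JE mul1r.
exact: (adjspan_colsum (valP M)).
Qed.

(** From J M = j_0(M) J follows rho(J) rho(M) = rho(J) j_0(M) for all M, so
    rho(J) <> 0 forces rho = j_0. *)
Lemma sum_character_neq (rho : character) :
  rho \in Xhat S -> rho != j0 S -> \sum_i rho (adj S i) = 0.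
Proof.
move=> rhoX; apply: contra_neq_eq; rewrite -rmorph_sum => J0.
apply: rmorph_ext => M; apply: (mulIf J0).
by rewrite mulrC -rmorphM sum_adj_absorb Xhat_scale.
Qed.

Lemma sum_j0 : \sum_i j0 S (adj S i) = #|X|%:R.
Proof.
rewrite -sum_valency natr_sum; apply: eq_bigr => i _.
by rewrite j0_adj.
Qed.

(** Summing an expansion over i amounts to evaluating it at J, where j_0 is the
    only character that does not vanish.  This is how q and m are found at j_0
    without describing V_{j_0}. *)
Lemma sum_Xhat_j0 (F : character -> R[i]) :
  \sum_i \sum_(rho <- Xhat S) rho (adj S i) * F rho = #|X|%:R * F (j0 S).
Proof.
rewrite exchange_big (bigD1_seq (j0 S)) ?j0_Xhat ?fset_uniq //=.
rewrite -mulr_suml sum_j0 big_seq_cond big1 ?addr0 // => rho /andP[rhoX rho_j0].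
by rewrite -mulr_suml sum_character_neq ?mul0r.
Qed.

Section Commutative.
Hypothesis Scomm : commutative_scheme S.

Lemma dim_eigsp_j0 : \dim (eigsp (j0 S)) = 1%N.
Proof.
have N0 : #|X|%:R != 0 :> R[i] by rewrite pnatr_eq0 -lt0n (scheme_nonempty S).
apply/eqP; rewrite -(eqr_nat R[i]); apply/eqP/(mulfI N0).
rewrite -(sum_Xhat_j0 (fun rho => (\dim (eigsp rho))%:R)).
rewrite (eq_bigr _ (fun i _ => esym (trace_spectral Scomm _))).
under eq_bigr do rewrite trace_adj.
by rewrite -mulr_sumr (bigD1 (idx0 S)) //= eqxx big1 ?addr0 // => i /negPf->.
Qed.

Lemma sum_dim_neq : \sum_(rho <- Xhat S | rho != j0 S) (\dim (eigsp rho))%:R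
  = #|X|%:R - 1 :> R.
Proof.
apply: complexI; rewrite rmorph_sum rmorphB rmorph_nat rmorph1.
apply/eqP; rewrite eq_sym subr_eq; apply/eqP.
transitivity (\tr (val (adj S (idx0 S)))).
  by rewrite trace_adj eqxx mulr1.
rewrite trace_spectral // (bigD1_seq (j0 S)) ?j0_Xhat ?fset_uniq //= addrC.
congr (_ + _); last by rewrite (character_idx0 (j0 S)) dim_eigsp_j0 mulr1.
by apply: eq_bigr => rho _; rewrite (character_idx0 rho) mul1r rmorph_nat.
Qed.

Section Subset.
Variable Y : {set X}.
Hypothesis Y0 : Y != set0.

Lemma lam_spectral i : (lam S Y i)%:R / #|Y|%:R ^+ 2 =
  \sum_(rho <- Xhat S) rho (adj S i) * (pnorm Y rho ^+ 2)%:C%C.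
Proof. by rewrite -inner_adj_avg quadratic_form_spectral. Qed.

Lemma cardY_neq0 (K : numDomainType) : #|Y|%:R != 0 :> K.
Proof. by rewrite pnatr_eq0 cards_eq0. Qed.

Lemma sqr_pnorm_j0 : pnorm Y (j0 S) ^+ 2 = #|X|%:R^-1.
Proof.
have N0 : #|X|%:R != 0 :> R[i] by rewrite pnatr_eq0 -lt0n (scheme_nonempty S).
apply: complexI; apply: (mulfI N0).
rewrite -(sum_Xhat_j0 (fun rho => (pnorm Y rho ^+ 2)%:C%C)).
rewrite -(eq_bigr _ (fun i _ => lam_spectral i)) -mulr_suml -natr_sum.
rewrite sum_lam.
by rewrite natrX divff ?expf_neq0 ?cardY_neq0 // fmorphV rmorph_nat divff.
Qed.

Lemma sum_sqr_pnorm_neq : \sum_(rho <- Xhat S | rho != j0 S) pnorm Y rho ^+ 2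
  = #|Y|%:R^-1 - #|X|%:R^-1.
Proof.
apply/eqP; rewrite eq_sym subr_eq; apply/eqP.
apply: complexI; rewrite rmorphD rmorph_sum /= -sqr_pnorm_j0.
transitivity ((lam S Y (idx0 S))%:R / #|Y|%:R ^+ 2 : R[i]).
  rewrite lam_idx0 fmorphV rmorph_nat expr2 invfM mulrA.
  by rewrite divff ?mul1r ?cardY_neq0.
rewrite lam_spectral (bigD1_seq (j0 S)) ?j0_Xhat ?fset_uniq //= addrC.
congr (_ + _); last by rewrite (character_idx0 (j0 S)) mul1r.
by apply: eq_bigr => rho _; rewrite (character_idx0 rho) mul1r.
Qed.

(** * Duality between distances and characters *)

Local Notation tau := ((#|Y|%:R^-1 - #|X|%:R^-1) / (#|X|%:R - 1) : R).

Lemma tau_ge0 : 0 <= tau.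
Proof.
have Y1 : (0 < #|Y|)%N by rewrite lt0n cards_eq0.
rewrite divr_ge0 ?subr_ge0 ?lef_pV2 ?posrE ?ltr0n ?ler_nat ?max_card //.
  exact: leq_trans Y1 (max_card _).
by rewrite ler1n (leq_trans Y1) ?max_card.
Qed.

(** If N = 1, then Y = X and both sides vanish. *)
Lemma tau_mul : tau * (#|X|%:R - 1) = #|Y|%:R^-1 - #|X|%:R^-1.
Proof.
have [N1|N1] := eqVneq (#|X|%:R - 1 : R) 0; last by rewrite divfK.
rewrite N1 mulr0.
have : #|X|%:R == 1 :> R by rewrite -subr_eq0 N1.
rewrite pnatr_eq1 => /eqP X1.
have Y1 : #|Y| = 1%N.
  by apply/eqP; rewrite eqn_leq -{1}X1 max_card lt0n cards_eq0.
by rewrite X1 Y1 subrr.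
Qed.

(** The coefficients a rho and the defects d i correspond under the characters,
    and the assumption on t is what makes d vanish at i_0. *)
Lemma design_duality (t : R) :
  t * (#|X|%:R - 1) = #|Y|%:R^-1 - #|X|%:R^-1 ->
  (forall rho, rho \in Xhat S -> rho != j0 S ->
     pnorm Y rho ^+ 2 = t * (\dim (eigsp rho))%:R) <->
  (forall i, i != idx0 S -> (lam S Y i)%:R / #|Y|%:R ^+ 2
     = (valency S i)%:R * (#|X|%:R^-1 - t) :> R).
Proof.
move=> tE; pose a (rho : character) : R[i] :=
  (pnorm Y rho ^+ 2 - t * (\dim (eigsp rho))%:R
  - (#|X|%:R^-1 - t) * (rho == j0 S)%:R)%:C%C.
pose d i : R := (lam S Y i)%:R / #|Y|%:R ^+ 2 - t * (#|X|%:R * (i == idx0 S)%:R)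
  - (#|X|%:R^-1 - t) * (valency S i)%:R.
have aE (rho : character) : rho != j0 S ->
    a rho = (pnorm Y rho ^+ 2 - t * (\dim (eigsp rho))%:R)%:C%C.
  by move=> /negPf rho_j0; rewrite /a rho_j0 mulr0 subr0.
have a0 : a (j0 S) = 0.
  by rewrite /a eqxx sqr_pnorm_j0 dim_eigsp_j0 !mulr1 subrr.
have dE i : i != idx0 S -> d i = (lam S Y i)%:R / #|Y|%:R ^+ 2
    - (valency S i)%:R * (#|X|%:R^-1 - t).
  by move=> /negPf ii0; rewrite /d ii0 !mulr0 subr0 [_ * _%:R]mulrC.
have d0 : d (idx0 S) = 0.
  rewrite /d eqxx lam_idx0 valency_idx0 !mulr1.
  rewrite expr2 invfM mulrA divff ?cardY_neq0 // mul1r.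
  by have := tE; lra.
have sum_a i : \sum_(rho <- Xhat S) rho (adj S i) * a rho = (d i)%:C%C.
  rewrite /d /a; move: (_ - t) => b.
  rewrite !rmorphB !rmorphM /= fmorphV rmorphXn /= !rmorph_nat.
  rewrite lam_spectral -trace_adj trace_spectral // -j0_adj.
  rewrite mulr_sumr -sumrB.
  have -> : (b%:C%C * j0 S (adj S i)) =
     \sum_(rho <- Xhat S) b%:C%C * rho (adj S i) * (rho == j0 S)%:R.
    rewrite (bigD1_seq (j0 S)) ?j0_Xhat ?fset_uniq //= eqxx mulr1.
    by rewrite big1 ?addr0 // => rho /negPf->; rewrite mulr0.
  rewrite -sumrB; apply: eq_bigr => rho _.
  rewrite !rmorphB !rmorphM /= !rmorph_nat.
  by rewrite !mulrBr !mulrA [t%:C%C * _]mulrC [b%:C%C * _]mulrC.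
split=> [h i ii0|h rho rhoX rho_j0].
  apply/eqP; rewrite -subr_eq0 -dE //; apply/eqP/complexI; rewrite -sum_a.
  rewrite rmorph0 big_seq big1 // => rho rhoX.
  have [->|rho_j0] := eqVneq rho (j0 S); first by rewrite a0 mulr0.
  by rewrite aE // h // subrr mulr0.
apply/eqP; rewrite -subr_eq0; apply/eqP/complexI; rewrite -aE // rmorph0.
apply: (character_independence _ rhoX) => i; rewrite sum_a.
have [->|ii0] := eqVneq i (idx0 S); first by rewrite d0.
by rewrite dE // h // subrr.
Qed.
End Subset.
End Commutative.

(** * Ratios and their maximum *)

Lemma dim_eigsp_gt0 (rho : character) :
  rho \in Xhat S -> (0 < \dim (eigsp rho))%N.
Proof.
move=> rhoX; have /XhatP[v v0 act] := rhoX.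
rewrite lt0n dimv_eq0; apply: contra v0 => /eqP e.
have: v \in eigsp rho by apply/eigspP.
by rewrite e memv0.
Qed.

Lemma ratio_sqrt (Y : {set X}) (rho : character) : rho \in Xhat S ->
  pnorm Y rho / Num.sqrt (\dim (eigsp rho))%:R
  = Num.sqrt (pnorm Y rho ^+ 2 / (\dim (eigsp rho))%:R).
Proof.
move=> rhoX; rewrite sqrtrM ?sqr_ge0 // sqrtr_sqr sqrtrV ?ler0n //.
by rewrite ger0_norm // sqrtr_ge0.
Qed.

Lemma ratio_eqP (Y : {set X}) (rho : character) (t : R) :
  rho \in Xhat S -> 0 <= t ->
  pnorm Y rho / Num.sqrt (\dim (eigsp rho))%:R = Num.sqrt t <->
  pnorm Y rho ^+ 2 = t * (\dim (eigsp rho))%:R.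
Proof.
move=> rhoX t0.
have m0 : 0 < (\dim (eigsp rho))%:R :> R by rewrite ltr0n dim_eigsp_gt0.
rewrite ratio_sqrt //; split=> [/eqP|->]; last by rewrite mulfK ?gt_eqF.
rewrite eqr_sqrt ?divr_ge0 ?sqr_ge0 ?ler0n // => /eqP<-.
by rewrite divfK ?gt_eqF.
Qed.

Lemma ratio_leP (Y : {set X}) (rho : character) (t : R) :
  rho \in Xhat S -> 0 <= t ->
  (pnorm Y rho / Num.sqrt (\dim (eigsp rho))%:R <= Num.sqrt t) =
  (pnorm Y rho ^+ 2 <= t * (\dim (eigsp rho))%:R).
Proof.
move=> rhoX t0.
have m0 : 0 < (\dim (eigsp rho))%:R :> R by rewrite ltr0n dim_eigsp_gt0.
by rewrite ratio_sqrt // ler_sqrt // ler_pdivrMr.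
Qed.

Section Equivalences.
Hypothesis Scomm : commutative_scheme S.
Variable Y : {set X}.
Hypothesis Y0 : Y != set0.
Local Notation tau := ((#|Y|%:R^-1 - #|X|%:R^-1) / (#|X|%:R - 1) : R).

(** If q_rho = t m_rho for all rho <> j_0, then summing over rho gives
    t (N - 1) = 1/#|Y| - 1/N. *)
Lemma equal_ratios :
  (forall rho sigma, rho \in Xhat S -> rho != j0 S ->
     sigma \in Xhat S -> sigma != j0 S ->
     pnorm Y rho / Num.sqrt (\dim (eigsp rho))%:R
       = pnorm Y sigma / Num.sqrt (\dim (eigsp sigma))%:R) ->
  forall rho, rho \in Xhat S -> rho != j0 S ->
    pnorm Y rho ^+ 2 = tau * (\dim (eigsp rho))%:R.
Proof.
move=> same rho rhoX rho_j0; pose t := pnorm Y rho ^+ 2 / (\dim (eigsp rho))%:R.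
have m0 : 0 < (\dim (eigsp rho))%:R :> R by rewrite ltr0n dim_eigsp_gt0.
have tE sigma : sigma \in Xhat S -> sigma != j0 S ->
    pnorm Y sigma ^+ 2 = t * (\dim (eigsp sigma))%:R.
  move=> sX sj; apply/ratio_eqP; rewrite ?divr_ge0 ?sqr_ge0 ?ler0n //.
  by rewrite (same _ rho) // ratio_sqrt.
have N1 : 0 < #|X|%:R - 1 :> R.
  rewrite -(sum_dim_neq Scomm) (big_rem rho) //= rho_j0.
  by apply: (ltr_pwDl m0); apply: sumr_ge0 => sigma _; apply: ler0n.
suff -> : tau = t by exact: tE.
apply: (mulIf (lt0r_neq0 N1)); rewrite divfK ?gt_eqF //.
rewrite -(sum_sqr_pnorm_neq Scomm Y0) -(sum_dim_neq Scomm) mulr_sumr.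
rewrite big_seq_cond [RHS]big_seq_cond; apply: eq_bigr => sigma /andP[sX sj].
exact: tE.
Qed.

(** The sums of q_rho and of tau m_rho over rho <> j_0 agree, so as soon as
    tau m_rho - q_rho is never negative it is always zero. *)
Lemma maxratio_eqP : maxratio S Y = Num.sqrt tau <->
  forall rho, rho \in Xhat S -> rho != j0 S ->
    pnorm Y rho ^+ 2 = tau * (\dim (eigsp rho))%:R.
Proof.
have tau0 : 0 <= tau by exact: tau_ge0.
split=> [maxE rho rhoX rho_j0|eqtau].
  have le sigma : (sigma \in Xhat S) && (sigma != j0 S) ->
      0 <= tau * (\dim (eigsp sigma))%:R - pnorm Y sigma ^+ 2.
    move=> /andP[sX sj]; rewrite subr_ge0 -ratio_leP // -maxE.
    exact: (le_bigmax_seq 0 _ _ _ sX sj).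
  have := psumr_eq0 (Xhat S) le; rewrite -big_seq_cond sumrB -mulr_sumr.
  rewrite sum_dim_neq // sum_sqr_pnorm_neq // (tau_mul Y0) subrr eqxx.
  move=> /esym/allP/(_ rho rhoX); rewrite rhoX rho_j0 /=.
  by rewrite subr_eq0 => /eqP.
have ratioE sigma : sigma \in Xhat S -> sigma != j0 S ->
    pnorm Y sigma / Num.sqrt (\dim (eigsp sigma))%:R = Num.sqrt tau.
  by move=> sX sj; apply/ratio_eqP => //; exact: eqtau.
have [[rho [rhoX rho_j0]]|none] :=
    pselect (exists rho, rho \in Xhat S /\ rho != j0 S).
  apply/eqP; rewrite eq_le; apply/andP; split.
    rewrite /maxratio big_seq_cond; apply: bigmax_le; first exact: sqrtr_ge0.
    by move=> sigma /andP[sX sj]; rewrite ratioE.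
  rewrite -(ratioE rho rhoX rho_j0).
  exact: (le_bigmax_seq 0 _ _ _ rhoX rho_j0).
(* No nontrivial character: N = 1, and both sides are 0. *)
have no sigma : (sigma \in Xhat S) && (sigma != j0 S) = false.
  by apply/negP => /andP[sX sj]; apply: none; exists sigma.
have N1 : #|X|%:R - 1 = 0 :> R.
  by rewrite -(sum_dim_neq Scomm) big_seq_cond big_pred0.
by rewrite N1 invr0 mulr0 sqrtr0 /maxratio big_seq_cond big_pred0.
Qed.

(** The value of lam_i / k_i required here is #|Y|^2 (1/N - tau). *)
Lemma uniform_lamP :
  (forall i, i != idx0 S -> (lam S Y i)%:R / (valency S i)%:R
     = (#|Y|%:R ^+ 2 - #|Y|%:R) / (#|X|%:R - 1) :> R) <->
  (forall rho, rho \in Xhat S -> rho != j0 S ->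
    pnorm Y rho ^+ 2 = tau * (\dim (eigsp rho))%:R).
Proof.
have Yn0 := cardY_neq0 Y0 R.
have N0 : #|X|%:R != 0 :> R by rewrite pnatr_eq0 -lt0n (scheme_nonempty S).
have k0 i : (valency S i)%:R != 0 :> R by rewrite pnatr_eq0 -lt0n valency_gt0.
rewrite (design_duality Scomm Y0 (tau_mul Y0)).
have sameE i : i != idx0 S -> ((lam S Y i)%:R / (valency S i)%:R
      == (#|Y|%:R ^+ 2 - #|Y|%:R) / (#|X|%:R - 1) :> R)
    = ((lam S Y i)%:R / #|Y|%:R ^+ 2 == (valency S i)%:R * (#|X|%:R^-1 - tau)).
  move=> ii0; have /lt0r_neq0 N1 : 0 < #|X|%:R - 1 :> R := cardX_gt1 ii0.
  have -> : #|X|%:R^-1 - tau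
      = (#|Y|%:R ^+ 2 - #|Y|%:R) / (#|X|%:R - 1) / #|Y|%:R ^+ 2.
    by field; rewrite N1 N0 Yn0.
  rewrite mulrA (inj_eq (divIf (expf_neq0 2 Yn0))) [_%:R * (_ / _)]mulrC.
  by rewrite -[in RHS](inj_eq (divIf (k0 i))) mulfK.
split=> h i ii0; apply/eqP; first by rewrite -sameE // h.
by rewrite sameE // h.
Qed.

(** If lam_j = c k_j for all j <> i_0, then summing over j gives
    #|Y|^2 - #|Y| = c (N - 1). *)
Lemma equal_lam_ratios :
  (forall i j, i != idx0 S -> j != idx0 S ->
     (lam S Y i)%:R / (valency S i)%:R
       = (lam S Y j)%:R / (valency S j)%:R :> R) ->
  forall i, i != idx0 S -> (lam S Y i)%:R / (valency S i)%:R
     = (#|Y|%:R ^+ 2 - #|Y|%:R) / (#|X|%:R - 1) :> R.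
Proof.
move=> same i ii0.
have k0 j : (valency S j)%:R != 0 :> R by rewrite pnatr_eq0 -lt0n valency_gt0.
apply: (mulIf (lt0r_neq0 (cardX_gt1 ii0))).
rewrite divfK ?(lt0r_neq0 (cardX_gt1 ii0)) //.
rewrite -sum_valency_neq -sum_lam_neq mulr_sumr; apply: eq_bigr => j jj0.
by rewrite (same i j) // divfK.
Qed.
End Equivalences.
End AssociationScheme.

Theorem theorem5p15 (R : realType) (X C : finType) (S : assocScheme R X C)
    (Scomm : commutative_scheme S) (Y : {set X}) (Y0 : Y != set0) :
  [<->
   forall i j : C, i != idx0 S -> j != idx0 S ->
     (lam S Y i)%:R / (valency S i)%:R
       = (lam S Y j)%:R / (valency S j)%:R :> R;
   (forall i : C, i != idx0 S ->
     (lam S Y i)%:R / (valency S i)%:R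
       = (#|Y|%:R ^+ 2 - #|Y|%:R) / (#|X|%:R - 1) :> R)
   /\ lam S Y (idx0 S) = #|Y|;
   (forall rho, rho \in Xhat S -> rho != j0 S ->
     pnorm Y rho / Num.sqrt (\dim (eigsp rho))%:R
       = Num.sqrt ((#|Y|%:R^-1 - #|X|%:R^-1) / (#|X|%:R - 1)))
   /\ pnorm Y (j0 S) = Num.sqrt (#|X|%:R^-1);
   forall rho sigma, rho \in Xhat S -> rho != j0 S ->
     sigma \in Xhat S -> sigma != j0 S ->
     pnorm Y rho / Num.sqrt (\dim (eigsp rho))%:R
       = pnorm Y sigma / Num.sqrt (\dim (eigsp sigma))%:R;
   maxratio S Y
     = Num.sqrt ((#|Y|%:R^-1 - #|X|%:R^-1) / (#|X|%:R - 1))].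
Proof.
tfae.
- by move=> same; split; [exact: equal_lam_ratios | exact: lam_idx0].
- case=> /(uniform_lamP Scomm Y0) eqtau _; split=> [rho rhoX rho_j0|].
    by apply/ratio_eqP; [| exact: tau_ge0 | exact: eqtau].
  by rewrite -(sqr_pnorm_j0 Scomm Y0) sqrtr_sqr ger0_norm ?sqrtr_ge0.
- case=> eqtau _ rho sigma rhoX rho_j0 sX sj.
  exact: etrans (eqtau _ rhoX rho_j0) (esym (eqtau _ sX sj)).
- by move=> /(equal_ratios Scomm Y0)/(maxratio_eqP Scomm Y0).
move=> /(maxratio_eqP Scomm Y0)/(uniform_lamP Scomm Y0) eqL i j ii0 jj0.
exact: etrans (eqL _ ii0) (esym (eqL _ jj0)).
Qed.
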